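(* Let $p$ be an integer with $|p|>2$ and let $\varepsilon\in\mathbb{R}$. Let $A=\begin{bmatrix} p&0\\0&p\end{bmatrix}$ and $$\mathcal{D}_\varepsilon=\left\{\begin{bmatrix} i+a_{ij}\\ j+a_{ij}\end{bmatrix}:\ a_{ij}=\delta_{ij}\,\varepsilon,\quad i,j\in\{0,1,\dots,|p|-1\}\right\}\subset\mathbb{R}^2,$$ where $\delta_{ij}=1$ if $i=j$ and $\delta_{ij}=0$ if $i\ne j$. Let $T_\varepsilon$ be the self-similar set generated by $(A,\mathcal{D}_\varepsilon)$. Then $T_\varepsilon$ is connected if and only if $$|\varepsilon|\le\frac{(|p|-1)^2}{|p|-2}.$$
   Context: The self-similar set generated by $(A,\mathcal{D})$ (with $A$ an expanding similarity and $\mathcal{D}$ the given finite digit set) is the unique nonempty compact set $T$ with $T=\bigcup_{d\in\mathcal{D}}A^{-1}(T+d)$, i.e. the attractor of the iterated function system $x\mapsto A^{-1}(x+d)$, with one map for each digit, indexed by $(i,j)$. *)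

(* Defs.v *)
From HB Require Import structures.
From mathcomp Require Import all_boot all_order all_algebra.
From mathcomp Require Import all_classical all_reals all_analysis.
Set Implicit Arguments.
Unset Strict Implicit.
Unset Printing Implicit Defensive.
Import Order.TTheory GRing.Theory Num.Theory.
Import numFieldNormedType.Exports.
Local Open Scope classical_set_scope.
Local Open Scope ring_scope.

(* By Hutchinson's theorem, when A is an expanding similarity and D is finite
   and nonempty, exactly one set T satisfies this predicate. *)
Definition self_similar_set (R : realType) (n : nat)
    (A : 'M[R]_n) (D : set 'cV[R]_n) (T : set 'cV[R]_n) : Prop :=
  [/\ T !=set0, compact T &
      T = \bigcup_(d in D) [set invmx A *m (x + d) | x in T]].

Definition shift (R : realType) (eps : R) (i j : nat) : R :=
  if i == j then eps else 0.

Definition digit (R : realType) (eps : R) (i j : nat) : 'cV[R]_2 :=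
  \col_(k < 2) ((if k == 0 then i else j)%:R + shift eps i j).

Definition digit_set (R : realType) (p : int) (eps : R) : set 'cV[R]_2 :=
  [set d | exists i j : nat,
     [/\ (i < `|p|)%N, (j < `|p|)%N & d = digit eps i j]].

(* Main.v *)
Require Import Defs.
From HB Require Import structures.
From mathcomp Require Import all_boot all_order all_algebra.
From mathcomp Require Import all_classical all_reals all_analysis.
From mathcomp Require Import ring lra zify.
Set Implicit Arguments.
Unset Strict Implicit.
Unset Printing Implicit Defensive.
Import Order.TTheory GRing.Theory Num.Theory.
Import numFieldNormedType.Exports.
Local Open Scope classical_set_scope.
Local Open Scope ring_scope.

(** Write [m] for [|p|], [e] for [|eps|], and [D] for the digit set.  Two
    pieces [p^-1 (T + d)] and [p^-1 (T + d')] of [T] meet exactly when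
    [d' - d] is a difference of two points of [T].

    Connected implies the bound.  In each coordinate, [T] has diameter at most
    [(m - 1 + e) / (m - 1)], because the diameter [s] satisfies
    [m s <= s + (m - 1 + e)] ([self_similar_coord_diam]).  The union of the
    pieces with diagonal digits and the union of the others are closed,
    nonempty and cover [T], so when [T] is connected a diagonal piece meets an
    off-diagonal one.  The two entries of an off-diagonal digit are distinct,
    so one of them differs from the extreme value [m - 1] (or [0], according
    to the sign of [eps]); in that coordinate the two digits are at distance
    at least [e - (m - 2)].  Comparing with the diameter gives the bound
    ([connected_self_similar_small]).

    The bound implies connected.  A bounded set [S] such that every [s] in [S]
    has some [delta] in [D - D] with [p s - delta] in [S] is contained in
    [T - T] ([expanding_subset_diff]).  This is applied to the union of the
    square [[-1, 1]^2] and of the two segments of points [(1 + t, t)] and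
    [- (1 + t, t)], where [0 <= t <= e - (m - 1)] ([expansion_step]).
      - On the square, the differences [(m - 1 - 2k, m - 1 - 2l)] suffice: the
        squares of half-width 1 around them cover [[-m, m]^2], and such a
        difference is realised by the digits of indices [(m - 1 - k, m - 1 - l)]
        and [(k, l)], which are both diagonal or both off-diagonal.
      - On the segments, differences between a diagonal and an off-diagonal
        digit are used, or [(m - 1, 0)] for small [t]; the bound on [e] keeps
        the new parameter below [e - (m - 1)].
    Hence pieces of the same kind at neighbouring grid positions meet, and
    some diagonal piece meets some off-diagonal one ([diagonal_link]), so the
    graph of meeting pieces is connected ([grid_connected]).  This makes [T]
    connected ([self_similar_connected]): a property stable under steps of
    length less than [f / m] is, inside each piece, a property of [T] stable
    under steps of length less than [f], so induction on [n] shows that [T]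
    can be traversed by steps shorter than [f / m ^ n]. *)

(** * Self-similar sets in a normed space *)

Lemma expr_lt_eps (R : realType) (r e : R) :
  0 <= r < 1 -> 0 < e -> exists n, r ^+ n < e.
Proof.
move=> /andP[r0 r1] e0.
have /cvgrPdist_lt /(_ e e0) : (r ^+ n) @[n --> \oo] --> (0 : R).
  by apply: cvg_expr; rewrite ger0_norm.
case=> n _ /(_ n (leqnn n)) /=.
by rewrite sub0r normrN ger0_norm ?exprn_ge0 // => ?; exists n.
Qed.

Lemma compact_sub_closed (R : realType) (V : normedModType R) (A B : set V) :
  compact A -> compact B -> closed [set x - y | x in A & y in B].
Proof.
move=> cA cB.
have -> : [set x - y | x in A & y in B]
    = [set (fun z : V * V => z.1 - z.2) z | z in A `*` B].
  apply/seteqP; split => [_ [x Ax [y By <-]]|_ [[x y] [/= Ax By] <-]].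
    by exists (x, y).
  by exists x => //; exists y.
apply: compact_closed; first exact: norm_hausdorff.
apply: continuous_compact; last exact: compact_setX.
exact/continuous_subspaceT/sub_continuous.
Qed.

Lemma compact_norm_le (R : realType) (V : normedModType R) (T : set V) :
  compact T -> exists2 C : R, 0 <= C & forall x, T x -> `|x| <= C.
Proof.
move=> /compact_bounded [M [_ HM]].
exists (`|M| + 1); first by rewrite addr_ge0.
by apply: HM; rewrite (le_lt_trans (ler_norm M)) // ltrDl.
Qed.

Lemma closed_approx (R : realType) (V : normedModType R) (A : set V) (s : V) :
  closed A -> (forall e : R, 0 < e -> exists2 a, A a & `|s - a| < e) -> A s.
Proof.
move=> cA H; apply: cA => B /nbhs_ballP[e /= e0 He].
have [a Aa la] := H e e0; exists a; split => //.
by apply: He; rewrite -ball_normE.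
Qed.

(** A criterion for membership in [T - T].  If [S] is bounded and every [s] in
    [S] satisfies [q s = s' + (d - d')] for some [s'] in [S], iterating [n]
    times approximates [s] by elements of [T - T] up to [C / |q| ^ n]. *)
Lemma expanding_subset_diff (R : realType) (V : normedModType R) (q : R)
    (D T S : set V) (C : R) :
  1 < `|q| -> compact T -> T !=set0 ->
  (forall x d, T x -> D d -> T (q^-1 *: (x + d))) ->
  (forall s, S s -> `|s| <= C) ->
  (forall s, S s -> exists d d', [/\ D d, D d' & S (q *: s - (d - d'))]) ->
  forall s, S s -> exists x y, [/\ T x, T y & s = x - y].
Proof.
move=> q1 cT [x0 Tx0] TD SC SD.
have q0 : q != 0 by rewrite -normr_gt0 (lt_trans ltr01).
have [B B0 TB] := compact_norm_le cT.
have approx n s : S s -> exists x y, [/\ T x, T y &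
    `|s - (x - y)| <= `|q|^-1 ^+ n * C].
  elim: n s => [s Ss|n IH s Ss].
    by exists x0, x0; split => //; rewrite subrr subr0 expr0 mul1r SC.
  have [d [d' [Dd Dd' Ss']]] := SD _ Ss.
  have [x [y [Tx Ty xy]]] := IH _ Ss'.
  exists (q^-1 *: (x + d)), (q^-1 *: (y + d')); split; [exact: TD..|].
  rewrite exprS -mulrA; have -> : s - (q^-1 *: (x + d) - q^-1 *: (y + d'))
      = q^-1 *: (q *: s - (d - d') - (x - y)).
    rewrite -[s in LHS](scalerK q0) -!scalerBr; congr (_ *: _).
    by rewrite (opprD y) addrACA [x - y + _]addrC opprD addrA.
  by rewrite normrZ normfV ler_wpM2l // invr_ge0.
move=> s Ss.
suff [x Tx [y Ty e]] : [set x - y | x in T & y in T] s by exists x, y.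
apply: closed_approx; first exact: compact_sub_closed.
move=> e e0.
have C0 : 0 <= C by rewrite (le_trans _ (SC _ Ss)).
have [n Hn] : exists n, `|q|^-1 ^+ n < e / (C + 1).
  apply: expr_lt_eps; last by rewrite divr_gt0 // ltr_wpDl.
  by rewrite invr_ge0 normr_ge0 invf_lt1 // (lt_trans ltr01).
have [x [y [Tx Ty xy]]] := approx n s Ss.
exists (x - y); first by exists x => //; exists y.
apply: (le_lt_trans xy).
have h : `|q|^-1 ^+ n * (C + 1) < e by rewrite -ltr_pdivlMr // ltr_wpDl.
apply: le_lt_trans h; rewrite ler_wpM2l ?exprn_ge0 ?invr_ge0 // lerDl ler01 //.
Qed.

(** Moving inside [T] by a step of length less than [e] preserves [P]. *)
Definition step_closed (R : realType) (V : normedModType R) (T : set V)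
    (e : R) (P : V -> Prop) :=
  forall x y, T x -> T y -> `|x - y| < e -> P x -> P y.

(** A relatively clopen subset of [T] and its complement are compact, hence at
    positive distance from each other. *)
Lemma compact_connected (R : realType) (V : normedModType R) (T : set V) :
  compact T ->
  (forall (e : R) (P : V -> Prop), 0 < e -> step_closed T e P ->
     forall x y, T x -> T y -> P x -> P y) ->
  connected T.
Proof.
move=> cT H B [b Bb] [U oU BU] [F cF BF].
have cB : compact B by rewrite BF; apply: compact_closedI.
have cB' : compact (T `&` ~` U).
  by apply: compact_closedI => //; exact: open_closedC.
have nD : ~ [set x - y | x in B & y in T `&` ~` U] 0.
  move=> [x Bx [y [_ nUy] /eqP]]; rewrite subr_eq0 => /eqP xy.
  by move: Bx; rewrite BU xy => -[].
have [e e0 He] : exists2 e : R, 0 < e &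
    forall x y, B x -> T y -> `|x - y| < e -> U y.
  apply: contrapT => nex; apply: nD.
  apply: closed_approx; first exact: compact_sub_closed.
  move=> e e0; apply: contrapT => nex'; apply: nex; exists e => // x y Bx Ty xy.
  apply: contrapT => nUy; apply: nex'; exists (x - y); last first.
    by rewrite sub0r normrN.
  by exists x => //; exists y.
have TB : B b -> T b by rewrite BU => -[].
apply/seteqP; split => x; first by rewrite BU => -[].
move=> Tx; apply: (H e B e0 _ b x) => //; last exact: TB.
by move=> y z Ty Tz yz By; rewrite BU; split=> //; apply: (He y).
Qed.

(** Connectedness of the attractor when the graph of meeting pieces is
    connected.  The connectedness of that graph is expressed by saying that a
    property of digits inherited by neighbours passes from any digit to any
    other. *)
Lemma self_similar_connected (R : realType) (V : normedModType R) (q : R)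
    (D T : set V) :
  1 < `|q| -> compact T ->
  (forall x, T x <-> exists y d, [/\ T y, D d & x = q^-1 *: (y + d)]) ->
  (forall P : V -> Prop,
     (forall d d', D d -> D d' ->
        (exists x y, [/\ T x, T y & x + d = y + d']) -> P d -> P d') ->
     forall d d', D d -> D d' -> P d -> P d') ->
  connected T.
Proof.
move=> q1 cT TE HD; apply: compact_connected => // e P e0.
have q0 : q != 0 by rewrite -normr_gt0 (lt_trans ltr01).
have [B B0 TB] := compact_norm_le cT.
(* [2 * B] bounds the diameter of [T], so a single step shorter than [f] joins
   any two points: this is the base case. *)
have iter n f : step_closed T (`|q|^-1 ^+ n * f) P -> 2 * B < f ->
    forall x y, T x -> T y -> P x -> P y.
  elim: n P => [|n IH] {}P.
    rewrite expr0 mul1r => HP Bf x y Tx Ty; apply: HP => //.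
    apply: le_lt_trans Bf; rewrite (le_trans (ler_normB _ _)) //.
    by rewrite mulr2n mulrDl mul1r lerD // TB.
  move=> HP Bf.
  have TD x d : T x -> D d -> T (q^-1 *: (x + d)).
    by move=> Tx Dd; apply/TE; exists x, d.
  have piece d : D d -> forall x y, T x -> T y ->
      P (q^-1 *: (x + d)) -> P (q^-1 *: (y + d)).
    move=> Dd; apply: (IH (fun x => P (q^-1 *: (x + d)))) => //.
    move=> x y Tx Ty xy; apply: HP; [exact: TD..|].
    rewrite -scalerBr opprD addrACA subrr addr0 normrZ normfV exprS -mulrA.
    by rewrite ltr_pM2l // invr_gt0 (lt_trans ltr01).
  pose Q d := exists2 x, T x & P (q^-1 *: (x + d)).
  move=> x y /TE[x' [d [Tx' Dd ->]]] /TE[y' [d' [Ty' Dd' ->]]] Pd.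
  suff [z Tz Pz] : Q d' by apply: (piece _ _ z).
  apply: (HD Q _ d d') => //; last by exists x'.
  move=> c c' Dc Dc' [u [v [Tu Tv uv]]] [w Tw Pw].
  by exists v => //; rewrite -uv; apply: (piece _ _ w).
move=> HP.
have [n Hn] : exists n, `|q|^-1 ^+ n < e / (2 * B + 1).
  apply: expr_lt_eps; last by rewrite divr_gt0 // ltr_wpDl // mulr_ge0.
  by rewrite invr_ge0 normr_ge0 invf_lt1 // (lt_trans ltr01).
apply: (iter n (2 * B + 1)); last by rewrite ltrDl.
move=> x y Tx Ty xy; apply: HP => //; apply: (lt_trans xy).
by rewrite -ltr_pdivlMr // ltr_wpDl // mulr_ge0.
Qed.

(** * Differences of digits *)

(** The intervals [[k - 1, k]], for [k < m], cover [[-1, m - 1]]. *)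
Lemma nat_near (R : realType) (m : nat) (z : R) :
  (0 < m)%N -> -1 <= z <= m%:R - 1 -> exists2 k, (k < m)%N & z <= k%:R <= z + 1.
Proof.
elim: m => // m IH _; rewrite -natr1 => /andP[z1 z2].
have [m0|m0] := posnP m.
  by exists 0%N => //; rewrite m0 in z2; lra.
have [h|h] := leP z (m%:R - 1).
  have [|k km kz] := IH m0; first by lra.
  by exists k => //; rewrite ltnS ltnW.
by exists m => //; lra.
Qed.

Lemma natr_lt_bounds (R : realType) (m a : nat) :
  (a < m)%N -> 0 <= (a%:R : R) <= m%:R - 1.
Proof. by move=> am; rewrite ler0n /= lerBrDr natr1 ler_nat. Qed.

(** [(u, v)] is a difference of two digits, for base [m] and parameter [eps].
    The name [shift] is qualified, being also used for translations. *)
Definition digit_diff (R : realType) (m : nat) (eps u v : R) : Prop :=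
  exists i j i' j' : nat,
    [/\ [&& (i < m)%N, (j < m)%N, (i' < m)%N & (j' < m)%N],
        u = i%:R + Defs.shift eps i j - (i'%:R + Defs.shift eps i' j') &
        v = j%:R + Defs.shift eps i j - (j'%:R + Defs.shift eps i' j')].

Lemma digit_diffN (R : realType) (m : nat) (eps u v : R) :
  digit_diff m eps u v -> digit_diff m eps (- u) (- v).
Proof.
move=> [i [j [i' [j' [/and4P[hi hj hi' hj'] -> ->]]]]].
by exists i', j', i, j; split; rewrite ?opprB //; apply/and4P.
Qed.

(** Reversing the indices, [k |-> m - 1 - k], exchanges the digit sets of [eps]
    and [- eps] up to a point reflection. *)
Lemma digit_diff_opp (R : realType) (m : nat) (eps u v : R) :
  digit_diff m eps u v -> digit_diff m (- eps) u v.
Proof.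
move=> [i [j [i' [j' [/and4P[hi hj hi' hj'] -> ->]]]]].
have rev k : (k < m)%N -> (m.-1 - k)%:R = m.-1%:R - k%:R :> R.
  by move=> km; rewrite natrB //; lia.
have shiftE k l : (k < m)%N -> (l < m)%N ->
    Defs.shift (- eps) (m.-1 - k)%N (m.-1 - l)%N = - Defs.shift eps k l.
  move=> km lm; rewrite /Defs.shift.
  have -> : (m.-1 - k == m.-1 - l)%N = (k == l)%N by lia.
  by case: ifP; rewrite ?oppr0.
exists (m.-1 - i')%N, (m.-1 - j')%N, (m.-1 - i)%N, (m.-1 - j)%N.
by split; [lia|rewrite !rev ?shiftE //; ring..].
Qed.

Lemma digit_diff_norm (R : realType) (m : nat) (eps u v : R) :
  digit_diff m `|eps| u v -> digit_diff m eps u v.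
Proof.
by case: (ger0P eps) => // _ /digit_diff_opp; rewrite opprK.
Qed.

(** The region shown to be contained in [T - T] when [e = |eps|] satisfies the
    bound: the square [[-1, 1]^2], prolonged by two opposite diagonal segments
    when [e > m - 1]. *)
Definition expansion_region (R : realType) (m : nat) (e a b : R) : Prop :=
  (`|a| <= 1 /\ `|b| <= 1) \/
  exists2 t, 0 <= t <= e - (m%:R - 1) &
    (a = 1 + t /\ b = t) \/ (a = - (1 + t) /\ b = - t).

Lemma expansion_regionN (R : realType) (m : nat) (e a b : R) :
  expansion_region m e a b -> expansion_region m e (- a) (- b).
Proof.
case=> [[a1 b1]|[t t0 [[-> ->]|[-> ->]]]]; [left|right; exists t => //..].
- by rewrite !normrN.
- by right.
- by left; rewrite !opprK.
Qed.

Lemma expansion_region_le (R : realType) (m : nat) (e a b : R) :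
  (2 < m)%N -> e <= (m%:R - 1) ^+ 2 / (m%:R - 2) ->
  expansion_region m e a b -> `|a| <= 3 /\ `|b| <= 3.
Proof.
move=> m2; have M3 : 3 <= m%:R :> R by rewrite ler_nat.
rewrite ler_pdivlMr ?expr2; last by lra.
move=> he [[? ?]|[t /andP[t0 t1] h]]; first by split; lra.
have t2 : t <= 2 by nra.
by case: h => -[-> ->]; rewrite ?normrN !ger0_norm; lra.
Qed.

(** Both digits have indices related by [k |-> m - 1 - k], so their shifts
    cancel, whatever [e] is. *)
Lemma expansion_square (R : realType) (m : nat) (e a b : R) :
  (2 < m)%N -> `|a| <= 1 -> `|b| <= 1 ->
  exists u v, [/\ digit_diff m e u v,
    `|m%:R * a - u| <= 1 & `|m%:R * b - v| <= 1].
Proof.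
move=> m2; have M3 : 3 <= m%:R :> R by rewrite ler_nat.
have coord c : `|c| <= 1 -> exists2 k, (k < m)%N &
    `|m%:R * c - ((m.-1 - k)%:R - k%:R)| <= 1 :> R.
  rewrite ler_norml => /andP[c1 c2].
  have [||k km /andP[k1 k2]] := @nat_near R m ((m%:R - 1 - m%:R * c) / 2 - 2^-1).
  - by lia.
  - by apply/andP; split; nra.
  exists k => //; rewrite natrB; last by lia.
  have -> : m.-1%:R = m%:R - 1 :> R by rewrite -subn1 natrB //; lia.
  by rewrite ler_norml; lra.
move=> /coord[k km ka] /coord[l lm lb].
exists ((m.-1 - k)%:R - k%:R), ((m.-1 - l)%:R - l%:R); split => //.
exists (m.-1 - k)%N, (m.-1 - l)%N, k, l.
have -> : Defs.shift e (m.-1 - k)%N (m.-1 - l)%N = Defs.shift e k l.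
  rewrite /Defs.shift.
  by have -> : (m.-1 - k == m.-1 - l)%N = (k == l)%N by lia.
by split; [lia|ring..].
Qed.

(** The difference [(e + k, e + k - (m - 1))] of the digits of indices [(k, k)]
    and [(0, m - 1)] sends [(1 + t, t)] to [(1 + t', t')] with
    [t' = m t - e - k + m - 1].  Some [k < m] gives [-1 <= t' <= 0], unless [m t]
    is too small or too large. *)
Lemma expansion_segment (R : realType) (m : nat) (e t : R) :
  (2 < m)%N -> e <= (m%:R - 1) ^+ 2 / (m%:R - 2) ->
  0 <= t <= e - (m%:R - 1) ->
  exists u v, digit_diff m e u v /\
    expansion_region m e (m%:R * (1 + t) - u) (m%:R * t - v).
Proof.
move=> m2; have M3 : 3 <= m%:R :> R by rewrite ler_nat.
rewrite ler_pdivlMr ?expr2; last by lra.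
move=> he /andP[t0 t1].
have pE : m.-1%:R = m%:R - 1 :> R by rewrite -subn1 natrB //; lia.
have diag k : (k < m)%N -> digit_diff m e (k%:R + e) (k%:R + e - (m%:R - 1)).
  move=> km; exists k, k, 0%N, m.-1; rewrite /Defs.shift eqxx.
  have -> : (0%N == m.-1) = false by lia.
  by split; [lia|ring|rewrite pE; ring].
(* If [m t] is small, the difference [(m - 1, 0)] multiplies [t] by [m]. *)
have [ha|ha] := ltP (m%:R * t) (e - (m%:R - 1) - 1).
  exists (m%:R - 1), 0; split.
    exists m.-1, 1%N, 0%N, 1%N; rewrite /Defs.shift.
    have -> : (m.-1 == 1%N) = false by lia.
    by split; [lia|rewrite pE /=; ring|rewrite /=; ring].
  right; exists (m%:R * t); first by nra.
  by left; split; ring.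
have [hb|hb] := leP (m%:R * t) (m%:R - 1 + (e - (m%:R - 1))).
  have [||k km /andP[k1 k2]] := @nat_near R m (m%:R * t - (e - (m%:R - 1))).
  - by lia.
  - by lra.
  exists (k%:R + e), (k%:R + e - (m%:R - 1)); split; first exact: diag.
  by left; rewrite !ler_norml; split; lra.
(* If [m t] is large, [k = m - 1] is used, and the bound on [e] yields
   [t' <= e - (m - 1)]. *)
exists (m.-1%:R + e), (m.-1%:R + e - (m%:R - 1)).
split; first by apply: diag; lia.
right; exists (m%:R * t - e); last by left; rewrite pE; split; ring.
by apply/andP; split; nra.
Qed.

Lemma expansion_step (R : realType) (m : nat) (e a b : R) :
  (2 < m)%N -> e <= (m%:R - 1) ^+ 2 / (m%:R - 2) ->
  expansion_region m e a b ->
  exists u v, digit_diff m e u v /\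
    expansion_region m e (m%:R * a - u) (m%:R * b - v).
Proof.
move=> m2 he [[ha hb]|[t ht [[-> ->]|[-> ->]]]].
- have [u [v [d ? ?]]] := expansion_square e m2 ha hb.
  by exists u, v; split=> //; left.
- exact: expansion_segment.
have [u [v [d r]]] := expansion_segment m2 he ht.
exists (- u), (- v); split; first exact: digit_diffN.
by rewrite !mulrN -!opprD; exact: expansion_regionN.
Qed.

(** Differences between the digits of indices [(0, 0)] and [(k, k + 1)]. *)
Lemma diagonal_link (R : realType) (m : nat) (e : R) :
  (2 < m)%N -> 0 <= e ->
  exists2 k, (k.+1 < m)%N & expansion_region m e (e - k%:R) (e - k.+1%:R).
Proof.
move=> m2 e0.
have pE : m.-1%:R = m%:R - 1 :> R by rewrite -subn1 natrB //; lia.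
have [h|h] := leP (m%:R - 1) e.
  exists m.-2; first by lia.
  have -> : m.-2.+1 = m.-1 by lia.
  have -> : m.-2%:R = m%:R - 2 :> R by rewrite -subn2 natrB //; lia.
  rewrite pE; right; exists (e - (m%:R - 1)); [lra|left; split; ring].
have [||k km /andP[k1 k2]] := @nat_near R m.-1 (e - 1).
- by lia.
- by rewrite pE; lra.
exists k; first by lia.
by left; rewrite -natr1 !ler_norml; split; lra.
Qed.

(** * Adjacency of the pieces *)

(** In the grid of size [m], the positions above the diagonal, those below it,
    and the diagonal positions are each connected by moves to one of the eight
    neighbours; the move from [(1, 0)] to [(0, 1)] joins the first two classes,
    and a single link joins the diagonal to them. *)
Lemma grid_connected (m : nat) (P : nat -> nat -> Prop) :
  (2 < m)%N ->
  (forall i j i' j', (i < m)%N -> (j < m)%N -> (i' < m)%N -> (j' < m)%N ->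
     (i == j) = (i' == j') ->
     (i <= i'.+1)%N -> (i' <= i.+1)%N -> (j <= j'.+1)%N -> (j' <= j.+1)%N ->
     P i j -> P i' j') ->
  (exists a b c, [/\ [&& (a < m)%N, (b < m)%N & (c < m)%N], b != c &
     P a a <-> P b c]) ->
  forall i j i' j', (i < m)%N -> (j < m)%N -> (i' < m)%N -> (j' < m)%N ->
    P i j -> P i' j'.
Proof.
move=> m2 H.
have step i j i' j' : (i < m)%N -> (j < m)%N -> (i' < m)%N -> (j' < m)%N ->
    (i == j) = (i' == j') ->
    (i <= i'.+1)%N -> (i' <= i.+1)%N -> (j <= j'.+1)%N -> (j' <= j.+1)%N ->
    P i j <-> P i' j'.
  by move=> *; split; apply: H => //; apply/esym.
have diag i : (i < m)%N -> P i i <-> P 0%N 0%N.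
  elim: i => // i IH im; apply: iff_trans (IH _); last by lia.
  by apply: step; lia.
have above j i : (i < j)%N -> (j < m)%N -> P i j <-> P 0%N 1%N.
  elim: i => [|i IH] ij jm; last first.
    by apply: iff_trans (IH (ltnW ij) jm); apply: step; lia.
  elim: j ij jm => // -[//|j] IH _ jm.
  by apply: iff_trans (IH isT (ltnW jm)); apply: step; lia.
have below i j : (j < i)%N -> (i < m)%N -> P i j <-> P 0%N 1%N.
  elim: j => [|j IH] ij im; last first.
    by apply: iff_trans (IH (ltnW ij) im); apply: step; lia.
  elim: i ij im => // -[_ _ im|i IH _ im]; first by apply: step; lia.
  by apply: iff_trans (IH isT (ltnW im)); apply: step; lia.
have off i j : (i < m)%N -> (j < m)%N -> i != j -> P i j <-> P 0%N 1%N.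
  by move=> im jm; rewrite neq_ltn => /orP[ij|ij]; [apply: above|apply: below].
move=> [a [b [c [/and3P[am bm cm] bc Pabc]]]].
have all i j : (i < m)%N -> (j < m)%N -> P i j <-> P 0%N 1%N.
  move=> im jm; have [<-|ij] := eqVneq i j; last exact: off.
  apply: iff_trans (diag i im) _; apply: iff_trans (iff_sym (diag a am)) _.
  exact: iff_trans Pabc (off _ _ bm cm bc).
by move=> i j i' j' im jm im' jm' /(all _ _ im jm); apply: (all _ _ im' jm').2.
Qed.

(** * Coordinates in the plane *)

Lemma digitE0 (R : realType) (eps : R) (i j : nat) :
  digit eps i j 0 0 = i%:R + Defs.shift eps i j.
Proof. by rewrite mxE. Qed.

Lemma digitE1 (R : realType) (eps : R) (i j : nat) :
  digit eps i j 1 0 = j%:R + Defs.shift eps i j.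
Proof. by rewrite mxE. Qed.

Definition digitE := (digitE0, digitE1).

Lemma ord2_cases (k : 'I_2) : k = 0 \/ k = 1.
Proof. by case: k => -[|[|//]] k2; [left|right]; apply/val_inj. Qed.

Lemma cV2P (R : realType) (x y : 'cV[R]_2) :
  x 0 0 = y 0 0 -> x 1 0 = y 1 0 -> x = y.
Proof.
by move=> h0 h1; apply/matrixP => k l; rewrite !ord1; case: (ord2_cases k) => ->.
Qed.

Lemma cV2_norm_le (R : realType) (x : 'cV[R]_2) (C : R) :
  `|x 0 0| <= C -> `|x 1 0| <= C -> `|x| <= C.
Proof.
move=> h0 h1; rewrite /Num.norm /= mx_normrE.
apply: bigmax_le => [|[k l] _ /=]; first by rewrite (le_trans _ h0).
by rewrite ord1; case: (ord2_cases k) => ->.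
Qed.

Lemma coord_norm_le (R : realType) (x : 'cV[R]_2) (k : 'I_2) : `|x k 0| <= `|x|.
Proof.
rewrite [leRHS]/Num.norm /= mx_normrE.
exact: (le_bigmax _ (fun ij => `|x ij.1 ij.2|) (k, 0)).
Qed.

Lemma self_similarP (R : realType) (p : int) (eps : R) (T : set 'cV[R]_2) :
  self_similar_set (p%:~R%:M : 'M[R]_2) (digit_set p eps) T ->
  forall x, T x <->
    exists y d, [/\ T y, digit_set p eps d & x = (p%:~R)^-1 *: (y + d)].
Proof.
move=> [_ _ TE] x; rewrite [in X in X <-> _]TE; split.
  by move=> [d Dd [y Ty <-]]; exists y, d; rewrite invmx_scalar mul_scalar_mx.
by move=> [y [d [Ty Dd ->]]]; exists d => //; exists y => //;
  rewrite invmx_scalar mul_scalar_mx.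
Qed.

(** * The bound implies connectedness *)

Lemma digit_set_digit (R : realType) (p : int) (eps : R) (i j : nat) :
  (i < `|p|)%N -> (j < `|p|)%N -> digit_set p eps (digit eps i j).
Proof. by move=> ip jp; exists i, j. Qed.

Lemma intr_cases (R : realType) (p : int) :
  p%:~R = `|p|%N%:R :> R \/ p%:~R = - `|p|%N%:R :> R.
Proof.
by case: p => n; [left|right; rewrite NegzE mulrNz].
Qed.

Lemma intr_absz (R : realType) (p : int) : `|p%:~R| = `|p|%N%:R :> R.
Proof. by rewrite -intr_norm -natr_absz. Qed.

(** When [p < 0], the expansion step for [|p|] is applied with the opposite
    difference, the region being symmetric. *)
Lemma region_meet (R : realType) (p : int) (eps : R) (T : set 'cV[R]_2)
    (s : 'cV[R]_2) :
  (2 < `|p|)%N -> self_similar_set (p%:~R%:M : 'M[R]_2) (digit_set p eps) T ->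
  `|eps| <= (`|p|%N%:R - 1) ^+ 2 / (`|p|%N%:R - 2) ->
  expansion_region `|p|%N `|eps| (s 0 0) (s 1 0) ->
  exists x y, [/\ T x, T y & s = x - y].
Proof.
move=> p2 hT he.
have TE := self_similarP hT.
have [T0 cT _] := hT.
apply: (@expanding_subset_diff _ _ p%:~R (digit_set p eps) T
  [set s | expansion_region `|p|%N `|eps| (s 0 0) (s 1 0)] 3) => //.
- by rewrite intr_absz ltr1n; lia.
- by move=> x d Tx Dd; apply/TE; exists x, d.
- move=> {}s /= /(expansion_region_le p2 he)[h0 h1]; exact: cV2_norm_le.
move=> {}s /= /(expansion_step p2 he)[u [v [/digit_diff_norm]]].
move=> [i [j [i' [j' [/and4P[hi hj hi' hj'] -> ->]]]]] hs.
case: (intr_cases R p) => ->.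
  exists (digit eps i j), (digit eps i' j'); split; [exact: digit_set_digit..|].
  by rewrite !mxE in hs *.
exists (digit eps i' j'), (digit eps i j); split; [exact: digit_set_digit..|].
move: hs => /expansion_regionN; congr (expansion_region _ _ _ _);
  by rewrite !mxE /=; ring.
Qed.

Lemma self_similar_connected_small (R : realType) (p : int) (eps : R)
    (T : set 'cV[R]_2) :
  (2 < `|p|)%N -> self_similar_set (p%:~R%:M : 'M[R]_2) (digit_set p eps) T ->
  `|eps| <= (`|p|%N%:R - 1) ^+ 2 / (`|p|%N%:R - 2) ->
  connected T.
Proof.
move=> p2 hT he.
have [_ cT _] := hT.
apply: (@self_similar_connected _ _ p%:~R (digit_set p eps)) => //.
- by rewrite intr_absz ltr1n; lia.
- exact: self_similarP.
move=> P HP.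
have adj i j i' j' : (i < `|p|)%N -> (j < `|p|)%N -> (i' < `|p|)%N ->
    (j' < `|p|)%N ->
    expansion_region `|p|%N `|eps|
      (i'%:R + Defs.shift eps i' j' - (i%:R + Defs.shift eps i j))
      (j'%:R + Defs.shift eps i' j' - (j%:R + Defs.shift eps i j)) ->
    P (digit eps i j) <-> P (digit eps i' j').
  move=> hi hj hi' hj' hr.
  have [|x [y [Tx Ty xy]]] := @region_meet R p eps T
    (digit eps i' j' - digit eps i j) p2 hT he; first by rewrite !mxE.
  have e : x + digit eps i j = y + digit eps i' j'.
    by rewrite -(subrK y x) -xy addrC addrA addrAC addrC subrKA addrC.
  by split; apply: HP; try exact: digit_set_digit; [exists x, y|exists y, x].
have grid := @grid_connected `|p|%N (fun i j => P (digit eps i j)) p2.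
move=> d d' [i [j [hi hj ->]]] [i' [j' [hi' hj' ->]]].
apply: grid => // {i j i' j' hi hj hi' hj'}.
  move=> i j i' j' hi hj hi' hj' hij ii' i'i jj' j'j.
  apply: (adj _ _ _ _ hi hj hi' hj' _).1; left.
  rewrite /Defs.shift hij !ler_norml.
  by move: ii' i'i jj' j'j; rewrite -!(ler_nat R) -!natr1; split; lra.
have [k hk hr] := diagonal_link p2 (normr_ge0 eps).
have kk : (k == k.+1) = false by lia.
have [e0|e0] := leP 0 eps.
  exists 0%N, k, k.+1; split; [lia|lia|].
  apply: iff_sym; apply: adj; [lia..|].
  by rewrite /Defs.shift eqxx kk !addr0 add0r; rewrite {2 3}(ger0_norm e0) in hr.
have rev l : (l < `|p|)%N -> (`|p|.-1 - l)%:R = `|p|.-1%:R - l%:R :> R.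
  by move=> lp; rewrite natrB //; lia.
(* For [eps < 0] the link is reflected by [k |-> m - 1 - k]. *)
exists `|p|.-1, (`|p|.-1 - k)%N, (`|p|.-1 - k.+1)%N; split; [lia|lia|].
apply: iff_sym; apply: adj; [lia..|].
rewrite /Defs.shift eqxx.
have -> : (`|p|.-1 - k == `|p|.-1 - k.+1)%N = false by lia.
rewrite {2 3}(ltr0_norm e0) in hr; rewrite !rev //; last by lia.
move: hr => /expansion_regionN; congr (expansion_region _ _ _ _); ring.
Qed.

(** * Connectedness implies the bound *)

(** The supremum [s] of the distances in coordinate [k] satisfies
    [s <= (s + m - 1 + |eps|) / m]. *)
Lemma self_similar_coord_diam (R : realType) (p : int) (eps : R)
    (T : set 'cV[R]_2) (k : 'I_2) :
  (2 < `|p|)%N -> self_similar_set (p%:~R%:M : 'M[R]_2) (digit_set p eps) T ->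
  forall x y, T x -> T y ->
    `|x k 0 - y k 0| <= (`|p|%N%:R - 1 + `|eps|) / (`|p|%N%:R - 1).
Proof.
move=> p2 hT.
have TE := self_similarP hT.
have [[x0 Tx0] cT _] := hT.
have M3 : 3 <= `|p|%N%:R :> R by rewrite ler_nat.
set M := `|p|%N%:R in M3 *; set c := M - 1 + `|eps|.
have [C C0 TC] := compact_norm_le cT.
pose E := [set r | exists x y, [/\ T x, T y & r = `|x k 0 - y k 0|]].
have Eub : has_ubound E.
  exists (2 * C) => _ [x [y [Tx Ty ->]]].
  have hx := le_trans (coord_norm_le x k) (TC _ Tx).
  have hy := le_trans (coord_norm_le y k) (TC _ Ty).
  by rewrite (le_trans (ler_normB _ _)) // mulr2n mulrDl mul1r lerD.
have E0 : E !=set0 by exists `|x0 k 0 - x0 k 0|, x0, x0.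
have digit_le d d' : digit_set p eps d -> digit_set p eps d' ->
    `|d k 0 - d' k 0| <= c.
  move=> [i [j [hi hj ->]]] [i' [j' [hi' hj' ->]]].
  rewrite !mxE opprD addrACA (le_trans (ler_normD _ _)) // lerD //.
    have hI : ((if k == 0%R then i else j) < `|p|)%N by case: ifP.
    have hI' : ((if k == 0%R then i' else j') < `|p|)%N by case: ifP.
    have /andP[? ?] := natr_lt_bounds R hI.
    have /andP[? ?] := natr_lt_bounds R hI'.
    by rewrite ler_norml; lra.
  have := normr_ge0 eps.
  by rewrite /Defs.shift;
    case: ifP; case: ifP; rewrite ?subrr ?subr0 ?sub0r ?normr0 ?normrN.
have supE : sup E <= (sup E + c) / M.
  apply: ge_sup => // _ [_ [_ [/TE[x [d [Tx Dd ->]]] /TE[y [d' [Ty Dd' ->]]] ->]]].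
  rewrite !mxE -mulrBr normrM normfV intr_absz -/M mulrC.
  apply: ler_wpM2r; first by rewrite invr_ge0; lra.
  rewrite opprD addrACA (le_trans (ler_normD _ _)) // lerD //.
    by apply: ub_le_sup => //; exists x, y.
  exact: digit_le.
move=> x y Tx Ty; apply: (@le_trans _ _ (sup E)).
  by apply: ub_le_sup => //; exists x, y.
rewrite ler_pdivlMr; last by lra.
move: supE; rewrite ler_pdivlMr; last by lra.
by move=> h; lra.
Qed.

(** Union of the pieces of [T] whose digit indices [(i, j)] satisfy [Q]. *)
Definition pieces (R : realType) (p : int) (eps : R) (T : set 'cV[R]_2)
    (Q : nat -> nat -> bool) : set 'cV[R]_2 :=
  \bigcup_(ij in [set ij : nat * nat |
      [/\ (ij.1 < `|p|)%N, (ij.2 < `|p|)%N & Q ij.1 ij.2]])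
    [set (p%:~R)^-1 *: (y + digit eps ij.1 ij.2) | y in T].

Lemma pieces_sub (R : realType) (p : int) (eps : R) (T : set 'cV[R]_2)
    (Q : nat -> nat -> bool) :
  self_similar_set (p%:~R%:M : 'M[R]_2) (digit_set p eps) T ->
  pieces p eps T Q `<=` T.
Proof.
move=> hT _ [[i j] [/= hi hj _] [y Ty <-]].
apply/(self_similarP hT); exists y, (digit eps i j); split => //.
exact: digit_set_digit.
Qed.

Lemma pieces_closed (R : realType) (p : int) (eps : R) (T : set 'cV[R]_2)
    (Q : nat -> nat -> bool) :
  compact T -> closed (pieces p eps T Q).
Proof.
move=> cT; apply: closed_bigcup.
  apply: (@sub_finite_set _ _ (`I_`|p|%N `*` `I_`|p|%N)); last exact: finite_setX.
  by move=> [i j] /= [].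
move=> [i j] _ /=; apply: compact_closed; first exact: norm_hausdorff.
apply: continuous_compact => //; apply: continuous_subspaceT => y.
exact: (cvgZl_tmp (cvgD cvg_id (cvg_cst _))).
Qed.

(** Since [i'] and [j'] are distinct, one of them is at most
    [m - 2] and one is at least [1]. *)
Lemma eps_le_of_meet (R : realType) (m i i' j' : nat) (eps L : R) :
  (i < m)%N -> (i' < m)%N -> (j' < m)%N -> i' != j' ->
  `|i%:R + eps - i'%:R| <= L -> `|i%:R + eps - j'%:R| <= L ->
  `|eps| <= L + (m%:R - 2).
Proof.
wlog ij : i' j' / (i' < j')%N.
  move=> H hi hi' hj' ij h1 h2; move: (ij); rewrite neq_ltn => /orP[lt|lt].
    exact: (H i' j').
  by apply: (H j' i'); rewrite // eq_sym.
move=> /(natr_lt_bounds R)/andP[i1 i2] _ /[dup] hj' /(natr_lt_bounds R)/andP[j1 j2] _.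
have : i'.+1%:R <= j'%:R :> R by rewrite ler_nat.
rewrite -natr1 => h; have i0 : 0 <= i'%:R :> R by [].
rewrite !ler_norml => /andP[a b] /andP[a' b'].
by apply/andP; split; lra.
Qed.

Lemma connected_self_similar_small (R : realType) (p : int) (eps : R)
    (T : set 'cV[R]_2) :
  (2 < `|p|)%N -> self_similar_set (p%:~R%:M : 'M[R]_2) (digit_set p eps) T ->
  connected T ->
  `|eps| <= (`|p|%N%:R - 1) ^+ 2 / (`|p|%N%:R - 2).
Proof.
move=> p2 hT con.
have TE := self_similarP hT.
have [[x0 Tx0] cT _] := hT.
have M3 : 3 <= `|p|%N%:R :> R by rewrite ler_nat.
have M0 : p%:~R != 0 :> R by rewrite -normr_gt0 intr_absz; lra.
pose A := pieces p eps T (fun i j => i == j).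
pose B := pieces p eps T (fun i j => i != j).
have AT : A `<=` T by exact: pieces_sub.
have BT : B `<=` T by exact: pieces_sub.
have TAB x : T x -> A x \/ B x.
  move=> /TE[y [_ [Ty [i [j [hi hj ->]]] ->]]].
  by have [ij|ij] := boolP (i == j); [left|right]; exists (i, j) => //; exists y.
(* Otherwise [A] is relatively clopen in [T]; it would be all of [T]. *)
have [z [Az Bz]] : exists z, A z /\ B z.
  apply: contrapT => /forallNP AB.
  have eqA : A = T.
    apply: con; first by exists ((p%:~R)^-1 *: (x0 + digit eps 0 0)),
        (0%N, 0%N) => /=; [split=> //; lia|exists x0].
      exists (~` B); first exact/closed_openC/pieces_closed.
      apply/seteqP; split => x; first last.
        by move=> [/TAB[]].
      by move=> Ax; split; [exact: AT|move=> Bx; apply: (AB x)].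
    exists A; first exact: pieces_closed.
    by apply/esym/setIidr.
  have Bx : B ((p%:~R)^-1 *: (x0 + digit eps 0 1)).
    by exists (0%N, 1%N) => /=; [split=> //; lia|exists x0].
  by apply: (AB _ (conj _ Bx)); rewrite eqA; exact: BT.
move: Az Bz => [[i i2] [/= hi _ /eqP<-] [x Tx <-]].
move=> [[i' j'] [/= hi' hj' ij'] [y Ty] /(scalerI (invr_neq0 M0)) xy].
have xyk k : `|digit eps i i k 0 - digit eps i' j' k 0|
    <= (`|p|%N%:R - 1 + `|eps|) / (`|p|%N%:R - 1).
  have <- : y k 0 - x k 0 = digit eps i i k 0 - digit eps i' j' k 0.
    by move: xy => /matrixP/(_ k 0); rewrite [LHS]mxE [RHS]mxE => h; lra.
  exact: (self_similar_coord_diam k p2 hT).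
have := xyk 0; have := xyk 1.
rewrite !digitE /Defs.shift eqxx (negbTE ij') !addr0 => h1 h0.
have := eps_le_of_meet hi hi' hj' ij' h0 h1.
rewrite ler_pdivlMr; last by lra.
set c := _ / _ => h.
have : c * (`|p|%N%:R - 1) = `|p|%N%:R - 1 + `|eps| by rewrite divfK //; lra.
by move=> hc; nra.
Qed.

Theorem theorem1p3 (R : realType) (p : int) (hp : 2 < `|p|) (eps : R)
    (T : set 'cV[R]_2)
    (hT : self_similar_set (p%:~R%:M : 'M[R]_2) (digit_set p eps) T) :
  connected T <->
  `|eps| <= (`|p|%:~R - 1) ^+ 2 / (`|p|%:~R - 2).
Proof.
have p2 : (2 < `|p|)%N by lia.
rewrite -natr_absz; split.
  exact: connected_self_similar_small.
exact: self_similar_connected_small.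
Qed.
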